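(* Let $n\ge 3$ and let $K$ be a convex body in $\mathbb{R}^n$ such that all orthogonal projections of $K$ are completely symmetric, i.e. for every linear subspace $H$ of $\mathbb{R}^n$ with $1\le\dim H\le n-1$ the orthogonal projection $K|H$ of $K$ onto $H$ is completely symmetric as a subset of $H$. Then $K$ is an origin symmetric Euclidean ball (i.e. a Euclidean ball centered at the origin).
   Context: A convex body in $\mathbb{R}^n$ is a compact convex set with non-empty interior. For a finite-dimensional Euclidean space $H$, $ISO(H)$ denotes the group of all isometries of $H$. For $A\subseteq H$, its symmetry group is $Sym(A)=\{T\in ISO(H):TA=A\}$. A subgroup $G$ of $ISO(H)$ is called complete if every ellipsoid in $H$ (with non-empty interior in $H$) whose symmetry group contains $G$ is a ball of $H$. A (compact) subset $A$ of $H$ is called completely symmetric if its centroid is at the origin, i.e. $\int_A x\,dx=0$ (integration with respect to Lebesgue measure of $H$), and its symmetry group $Sym(A)$ is complete. *)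

(* Defs.v *)
From HB Require Import structures.
From mathcomp Require Import all_boot all_order all_algebra.
From mathcomp Require Import all_classical all_reals all_analysis.

Set Implicit Arguments.
Unset Strict Implicit.
Unset Printing Implicit Defensive.

Import Order.TTheory GRing.Theory Num.Theory.
Import numFieldNormedType.Exports.

Local Open Scope classical_set_scope.
Local Open Scope ring_scope.

Section lebesgue_cons.
Variables (R : realType) (k : nat).
Variable mu : {measure set (k.-tuple (measurableTypeR R)) -> \bar R}.

Lemma measurable_tuple_cons :
  measurable_fun setT
    (fun p : k.-tuple (measurableTypeR R) * measurableTypeR R =>
       cons_tuple p.2 p.1).
Proof. exact: (measurable_cons measurable_snd measurable_fst). Qed.

Definition lebesgue_cons : set (k.+1.-tuple (measurableTypeR R)) -> \bar R :=
  pushforward (mu \x lebesgue_measure)%E (fun p => cons_tuple p.2 p.1).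

HB.instance Definition _ := Measure.copy lebesgue_cons
  (measure_function_pushforward__canonical__measure_function_Measure
     (mu \x lebesgue_measure)%E measurable_tuple_cons).

End lebesgue_cons.

(* Lebesgue measure on the Borel sets of R^k, with R^k seen as k.-tuple R. *)
Fixpoint lebesgue_tuple (R : realType) (k : nat) :
    {measure set (k.-tuple (measurableTypeR R)) -> \bar R} :=
  match k with
  | 0 => dirac [tuple]
  | j.+1 => lebesgue_cons (lebesgue_tuple R j)
  end.

(* The norm the library puts on 'rV[R]_n is the sup norm: it induces the usual
   topology, but the Euclidean norm has to be introduced separately. *)
Definition dot (R : realType) (n : nat) (x y : 'rV[R]_n) : R :=
  \sum_(i < n) x 0 i * y 0 i.

Definition enorm (R : realType) (n : nat) (x : 'rV[R]_n) : R :=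
  Num.sqrt (dot x x).

Definition convex_body (R : realType) (n : nat) (K : set 'rV[R]_n) : Prop :=
  [/\ compact K, convex_set K & K° !=set0].

Section EuclideanSubspace.
Variables (R : realType) (n : nat) (H : {vspace 'rV[R]_n}).

Definition ISO : set (subvs_of H -> subvs_of H) :=
  [set T | bijective T /\
           forall x y, enorm (vsval (T x - T y)) = enorm (vsval (x - y))].

Definition Sym (A : set (subvs_of H)) : set (subvs_of H -> subvs_of H) :=
  [set T | ISO T /\ T @` A = A].

Definition is_ball (E : set (subvs_of H)) : Prop :=
  exists (c : subvs_of H) (r : R),
    0 < r /\ E = [set x | enorm (vsval (x - c)) <= r].

(* Affine images of the unit ball of H under x |-> c + L x with L invertible;
   the center c is arbitrary. *)
Definition is_ellipsoid (E : set (subvs_of H)) : Prop :=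
  exists (c : subvs_of H) (L : 'End(subvs_of H)),
    lker L = 0%VS /\
    E = [set c + L x | x in [set x : subvs_of H | enorm (vsval x) <= 1]].

Definition complete_group (G : set (subvs_of H -> subvs_of H)) : Prop :=
  forall E, is_ellipsoid E -> G `<=` Sym E -> is_ball E.

Definition orthonormal_basis (b : (\dim H).-tuple (subvs_of H)) : Prop :=
  forall i j, dot (vsval (tnth b i)) (vsval (tnth b j)) = (i == j)%:R.

Definition of_coords (b : (\dim H).-tuple (subvs_of H))
    (t : (\dim H).-tuple R) : subvs_of H :=
  \sum_i tnth t i *: tnth b i.

(* Lebesgue measure of H is the image of that of R^(\dim H) under the isometry
   of_coords b, for any orthonormal basis b of H (it does not depend on b);
   the equation \int_A x dx = 0 is then written coordinatewise in 'rV[R]_n. *)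
Definition centroid_at_origin (A : set (subvs_of H)) : Prop :=
  forall b, orthonormal_basis b -> forall j : 'I_n,
    (\int[lebesgue_tuple R (\dim H)]_(t in of_coords b @^-1` A)
       (vsval (of_coords b t) 0 j)%:E = 0)%E.

Definition completely_symmetric (A : set (subvs_of H)) : Prop :=
  centroid_at_origin A /\ complete_group (Sym A).

Definition orthogonal_projection (K : set 'rV[R]_n) : set (subvs_of H) :=
  [set y | exists2 x, K x & forall z : subvs_of H, dot (x - vsval y) (vsval z) = 0].

End EuclideanSubspace.
Arguments orthogonal_projection {R n} H K.

(* Main.v *)
(* Let h be the support function of K. Centroids of the projections onto lines
   make h even. If H is a plane, every symmetry of K|H is then linear and
   preserves h on the unit circle of H; were all rotations among these
   symmetries plus or minus the identity, a non-circular ellipse would be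
   invariant, so completeness makes the restriction of h to each great circle C
   invariant under a rotation by an angle outside pi Z. With evenness, h|C has
   least period pi/k with k >= 2, unless it is constant.

   Suppose some h|C is not constant and choose C with k least. That the least
   period of h|C exceeds pi/(k+1) is an open condition on C, so by minimality all
   great circles near C have period b = pi/k, that is, h u = h v whenever u and v
   are at angular distance b on a great circle near C. Two points of C close to
   each other can be joined by four such steps, through a point z slightly off C;
   hence h is locally constant on C, a contradiction. So h is constant on the unit
   sphere, and K is a ball. *)

Require Import Defs.
From HB Require Import structures.
From mathcomp Require Import all_boot all_order all_algebra.
From mathcomp Require Import all_classical all_reals all_analysis.
From mathcomp Require Import measurable_realfun.
From mathcomp Require Import lra.

Set Implicit Arguments.
Unset Strict Implicit.
Unset Printing Implicit Defensive.

Import Order.TTheory GRing.Theory Num.Theory.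
Import numFieldNormedType.Exports.

Local Open Scope classical_set_scope.
Local Open Scope ring_scope.

(** * Periods of functions of a real variable *)

Section Periods.
Variable R : realType.
Implicit Types (f : R -> R) (b d : R) (k : nat).

Lemma periodicN f b : periodic f b -> periodic f (- b).
Proof. by move=> fb u; rewrite -[in RHS](subrK b u) fb. Qed.

Lemma periodicD f b d : periodic f b -> periodic f d -> periodic f (b + d).
Proof. by move=> fb fd u; rewrite addrA fd fb. Qed.

Lemma periodic_mulrn f b k : periodic f b -> periodic f (b *+ k).
Proof. by move=> fb u; exact: periodicn. Qed.

Lemma periodic_mulrz f b (m : int) : periodic f b -> periodic f (b *~ m).
Proof.
case: m => m fb; first exact: periodic_mulrn.
by rewrite NegzE mulrNz; apply/periodicN/periodic_mulrn.
Qed.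

(* Unlike "the least period is at most d", this condition survives limits of
   functions, because the period is kept away from 0. *)
Definition has_period_near f d := exists2 c, d / 2 <= c <= d & periodic f c.

(** The largest multiple of [b] not exceeding [d] is at least [b] and greater than [d - b], hence at
    least [d / 2]. *)
Lemma has_period_near_le f b d :
  0 < b <= d -> periodic f b -> has_period_near f d.
Proof.
move=> /andP[b0 bd] fb.
have d0 : 0 <= d / b by apply: divr_ge0; lra.
have /andP[] := truncn_itv d0; set m := Num.truncn _.
rewrite ler_pdivlMr // ltr_pdivrMr // => md dm.
have m1 : (1 <= m)%N.
  rewrite lt0n; apply: contraTN dm => /eqP ->; rewrite mul1r -leNgt //.
exists (b *+ m); last exact: periodic_mulrn.
have : 1 * b <= m%:R * b by rewrite ler_pM2r // ler1n.
move: dm; rewrite -natr1 mulrDl mul1r -[b *+ m]mulr_natl => dm bm.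
apply/andP; split; lra.
Qed.

(** Reducing [b] modulo [pi] gives a period [r] strictly between 0 and [pi], and one of [r],
    [pi - r] is at most [pi / 2]. *)
Lemma periodic_pi_half f b :
  periodic f pi -> periodic f b -> sin b != 0 -> has_period_near f (pi / 2).
Proof.
move=> fpi fb sb; have pi0 := pi_gt0 R.
pose m := Num.floor (b / pi); pose r := b - pi *~ m.
have fr : periodic f r.
  by apply: periodicD => //; apply/periodicN/periodic_mulrz.
have /andP[] := floor_itv (b / pi); rewrite -/m.
rewrite ler_pdivlMr // ltr_pdivrMr // intrD mulrDl mul1r => mb bm.
have r0 : 0 <= r < pi by rewrite /r -mulrzl; apply/andP; split; lra.
have sr : r != 0.
  apply: contraNN sb => /eqP/subr0_eq ->; case: (m) => j.
    by rewrite -[_ *~ _]add0r (alternatingn (@sinDpi R)) sin0 mulr0.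
  rewrite NegzE mulrNz sinN -[_ *~ _]add0r.
  by rewrite (alternatingn (@sinDpi R)) sin0 mulr0 oppr0.
have {}r0 : 0 < r < pi by rewrite lt_neqAle eq_sym sr.
have [r2|r2] := leP r (pi / 2).
  by apply: has_period_near_le fr; lra.
apply: (@has_period_near_le f (pi - r)); first by lra.
by apply: periodicD => //; exact: periodicN.
Qed.

(** No positive period is at most [L = pi / (k + 1)]. If the remainder [r] of [pi] modulo [p] were
    nonzero, the periods [r] and [p - r] would both exceed [L], against [p <= pi / k <= 2 L]. So
    [pi = j p], and [L < p <= pi / k] forces [j = k]. *)
Lemma periodic_pi_div f k : (0 < k)%N -> periodic f pi ->
  has_period_near f (pi / k%:R) -> ~ has_period_near f (pi / k.+1%:R) ->
  periodic f (pi / k%:R).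
Proof.
move=> k0 fpi [p /andP[p1 p2] fp] nL; have pi0 := pi_gt0 R.
set L := pi / k.+1%:R in nL.
have kR : 0 < k%:R :> R by rewrite ltr0n.
have kR1 : 0 < k.+1%:R :> R by rewrite ltr0n.
have noper b : periodic f b -> 0 < b -> L < b.
  move=> fb b0; rewrite ltNge; apply/negP => bL.
  by apply: nL; apply: (has_period_near_le _ fb); rewrite b0.
have piL : pi = k.+1%:R * L by rewrite mulrC divfK ?lt0r_neq0.
have pik : (pi : R) = k%:R * (pi / k%:R) by rewrite mulrC divfK ?lt0r_neq0.
have L0 : 0 < L by rewrite divr_gt0.
have pk0 : 0 < (pi : R) / k%:R by rewrite divr_gt0.
have pL : L < p by apply: noper => //; lra.
(* pi / k - L = pi / (k (k + 1)) is at most L *)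
have kL : (pi : R) / k%:R <= L *+ 2.
  rewrite ler_pdivrMr // mulr2n mulrDl.
  have : 1 <= k%:R :> R by rewrite ler1n.
  move: piL; rewrite -natr1 => piL k1; nra.
have pip : 0 <= pi / p by apply: divr_ge0; lra.
have p0 : 0 < p by lra.
have /andP[] := truncn_itv pip; move: (Num.truncn _) => j.
rewrite ler_pdivlMr // ltr_pdivrMr // -natr1 mulrDl mul1r => jp pj.
pose r := pi - p *+ j.
have fr : periodic f r.
  by apply: periodicD => //; apply/periodicN/periodic_mulrn.
have rE : r = pi - j%:R * p by rewrite /r -[p *+ j]mulr_natl.
have r0 : r = 0.
  apply/eqP/negPn/negP => rn0.
  have rL : L < r by apply: noper => //; rewrite lt_neqAle eq_sym rn0; lra.
  have := noper (p - r) (periodicD fp (periodicN fr)).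
  rewrite mulr2n in kL.
  by move=> /(_ ltac:(lra)); lra.
have jpi : (pi : R) = j%:R * p by lra.
have jk : j = k.
  apply/eqP; rewrite eqn_leq; apply/andP; split.
    rewrite -ltnS -(ltr_nat R) -(ltr_pM2r L0) -piL jpi.
    rewrite ltr_pM2l // ltr0n lt0n; apply/negP => /eqP j0.
    by move: pi0; rewrite jpi j0 mul0r ltxx.
  have := ler_wpM2l (ler0n R j) p2; rewrite -jpi => pj2.
  by rewrite -(ler_nat R) -(ler_pM2r pk0) -pik.
by rewrite jpi jk mulrAC divff ?mul1r // lt0r_neq0.
Qed.

(** Modulo an arbitrarily small period every [t] comes close to 0, where continuity controls [f]. *)
Lemma small_periods_cst f : continuous f ->
  (forall k, (2 <= k)%N -> has_period_near f (pi / k%:R)) ->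
  forall t, f t = f 0.
Proof.
move=> cf fk t; have pi0 := pi_gt0 R.
apply/eqP; rewrite -subr_eq0 -normr_le0; apply/ler_addgt0Pl => e e0.
rewrite addr0; move: (cf 0) => /cvgrPdist_le /(_ e e0) /nbhs_ballP[d /= d0 dP].
pose k := (Num.truncn (pi / d)).+2.
have kd : pi / k%:R < d.
  rewrite ltr_pdivrMr // mulrC -ltr_pdivrMr //.
  have /andP[_ /lt_le_trans -> //] : (Num.truncn (pi / d))%:R <= pi / d
      < (Num.truncn (pi / d)).+1%:R by apply: truncn_itv; rewrite divr_ge0 ?ltW.
  by rewrite ler_nat.
have pk0 : 0 < (pi : R) / k%:R by rewrite divr_gt0.
have [//|b /andP[b1 b2] fb] := fk k.
have b0 : 0 < b by lra.
have /andP[] := floor_itv (t / b); set m := Num.floor _.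
rewrite ler_pdivlMr // ltr_pdivrMr // intrD mulrDl mul1r => mt tm.
have -> : f t = f (t - b *~ m).
  by rewrite (periodicN (periodic_mulrz m fb)).
rewrite distrC; apply: dP; rewrite /ball /= sub0r normrN -mulrzl.
by rewrite ger0_norm; lra.
Qed.

End Periods.

(** * Great circles *)

Section Circles.
Variables (R : realType) (n : nat).
Implicit Types (x y z e u v : 'rV[R]_n) (a s t : R).

Lemma dotC x y : dot x y = dot y x.
Proof. by apply: eq_bigr => i _; rewrite mulrC. Qed.

Lemma dotDl x y z : dot (x + y) z = dot x z + dot y z.
Proof. by rewrite -big_split; apply: eq_bigr => i _; rewrite mxE mulrDl. Qed.

Lemma dotZl a x y : dot (a *: x) y = a * dot x y.
Proof. by rewrite mulr_sumr; apply: eq_bigr => i _; rewrite mxE mulrA. Qed.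

Lemma dotNl x y : dot (- x) y = - dot x y.
Proof. by rewrite -scaleN1r dotZl mulN1r. Qed.

Lemma dot0l x : dot 0 x = 0.
Proof. by rewrite -(scale0r 0) dotZl mul0r. Qed.

Lemma dotDr x y z : dot x (y + z) = dot x y + dot x z.
Proof. by rewrite dotC dotDl !(dotC x). Qed.

Lemma dotZr a x y : dot x (a *: y) = a * dot x y.
Proof. by rewrite dotC dotZl dotC. Qed.

Lemma dotNr x y : dot x (- y) = - dot x y.
Proof. by rewrite dotC dotNl dotC. Qed.

Definition dotE := (dotDl, dotDr, dotZl, dotZr, dotNl, dotNr).

Lemma dot_ge0 x : 0 <= dot x x.
Proof. by apply: sumr_ge0 => i _; rewrite -expr2 sqr_ge0. Qed.

Lemma enorm_sqr x : enorm x ^+ 2 = dot x x.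
Proof. by rewrite sqr_sqrtr ?dot_ge0. Qed.

Lemma dot_eq0 x : (dot x x == 0) = (x == 0).
Proof.
apply/eqP/eqP => [/eqP|->]; last exact: dot0l.
rewrite psumr_eq0 => [/allP x0|i _]; last by rewrite -expr2 sqr_ge0.
apply/rowP => i; rewrite mxE; apply/eqP.
by have := x0 i (mem_index_enum i); rewrite mulf_eq0 orbb.
Qed.

Lemma dot_gt0 x : x != 0 -> 0 < dot x x.
Proof. by move=> x0; rewrite lt_neqAle eq_sym dot_eq0 x0 dot_ge0. Qed.

Definition orthonormal2 x y := [/\ dot x x = 1, dot y y = 1 & dot x y = 0].

Lemma normalize_dot x : x != 0 -> exists2 a, 0 < a & dot (a *: x) (a *: x) = 1.
Proof.
move=> /dot_gt0 x0; have s0 : 0 < Num.sqrt (dot x x) by rewrite sqrtr_gt0.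
exists (Num.sqrt (dot x x))^-1; first by rewrite invr_gt0.
rewrite !dotE -[X in _ * (_ * X)](sqr_sqrtr (ltW x0)) expr2.
by rewrite mulKf ?mulVf // lt0r_neq0.
Qed.

(** The matrix with columns [e1], [e2] has rank at most 2, so with at least 3 rows its left kernel
    is nonzero. *)
Lemma dim3_orthogonal e1 e2 : (3 <= n)%N ->
  exists e3, [/\ dot e3 e3 = 1, dot e1 e3 = 0 & dot e2 e3 = 0].
Proof.
move=> n3; pose M := (row_mx e1^T e2^T : 'M[R]_(n, 1 + 1)).
have /rowV0Pn[v /sub_kermxP vM v0] : kermx M != 0.
  rewrite kermx_eq0 /row_free; apply/eqP => rM.
  by have := rank_leq_col M; rewrite rM leqNgt n3.
have [a _ av1] := normalize_dot v0.
move: vM; rewrite mul_mx_row -(row_mx0 R 1 1 1) => /eq_row_mx[v1 v2].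
have dotM x y : dot x y = (y *m x^T) 0 0.
  by rewrite mxE dotC; apply: eq_bigr => i _; rewrite mxE.
by exists (a *: v); split => //; rewrite dotZr dotM (v1, v2) mxE mulr0.
Qed.

Definition circ e1 e2 t := cos t *: e1 + sin t *: e2.

Lemma circ0 e1 e2 : circ e1 e2 0 = e1.
Proof. by rewrite /circ cos0 sin0 scale1r scale0r addr0. Qed.

Lemma circDpi e1 e2 t : circ e1 e2 (t + pi) = - circ e1 e2 t.
Proof. by rewrite /circ cosDpi sinDpi !scaleNr -opprD. Qed.

(** The frame rotated by [s] parametrises the same circle from its point at angle [s]. Results near
    the first vector of a frame thereby apply at every point of the circle. *)
Lemma circD e1 e2 s t :
  circ e1 e2 (s + t) = circ (circ e1 e2 s) (circ e1 e2 (s + pi / 2)) t.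
Proof.
rewrite /circ cosDpihalf sinDpihalf cosD sinD !scalerDr !scalerA addrACA.
by rewrite -!scalerDl; congr (_ *: _ + _ *: _); lra.
Qed.

Lemma circ_orthonormal2 e1 e2 s : orthonormal2 e1 e2 ->
  orthonormal2 (circ e1 e2 s) (circ e1 e2 (s + pi / 2)).
Proof.
move=> [e11 e22 e12]; rewrite /orthonormal2 /circ cosDpihalf sinDpihalf.
have := cos2Dsin2 s; rewrite !dotE (dotC e2 e1) e11 e22 e12.
by split; lra.
Qed.

Lemma unit_pair_circ a b : a ^+ 2 + b ^+ 2 = 1 ->
  exists t, a = cos t /\ b = sin t.
Proof.
move=> ab; have a1 : -1 <= a <= 1 by apply/andP; split; nra.
have ca : cos (acos a) = a by rewrite acosK // in_itv.
have sa : sin (acos a) = `|b|.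
  by rewrite sin_acos // -sqrtr_sqr; congr Num.sqrt; lra.
have [b0|b0] := leP 0 b.
  by exists (acos a); rewrite sa ger0_norm.
by exists (- acos a); rewrite cosN sinN sa ltr0_norm // opprK.
Qed.

Lemma cvg_circ T (F : set_system T) (FF : Filter F)
    (f1 f2 : T -> 'rV[R]_n) (g : T -> R) e1 e2 t :
  f1 @ F --> e1 -> f2 @ F --> e2 -> g @ F --> t ->
  circ (f1 x) (f2 x) (g x) @[x --> F] --> circ e1 e2 t.
Proof.
move=> f1e f2e gt; apply: cvgD; apply: cvgZ => //.
  by apply: (continuous_cvg _ _ gt); exact: continuous_cos.
by apply: (continuous_cvg _ _ gt); exact: continuous_sin.
Qed.

Lemma continuous_circ e1 e2 : continuous (circ e1 e2).
Proof. by move=> t; apply: cvg_circ; [exact: cvg_cst|exact: cvg_cst|exact: cvg_id]. Qed.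

(** Each [b] in the segment from [d / 2] to [d] is refuted at some [t] by an inequality that
    persists for nearby [b] and nearby frames. Compactness of the segment yields one neighbourhood
    of frames for all [b]. *)
Lemma near_no_period (h : 'rV[R]_n -> R) e1 e2 d : continuous h ->
  ~ has_period_near (h \o circ e1 e2) d ->
  \forall x \near e1 & y \near e2, ~ has_period_near (h \o circ x y) d.
Proof.
move=> ch nd.
pose P (e : 'rV[R]_n * 'rV[R]_n) (b : R) :=
  exists t, h (circ e.1 e.2 (t + b)) != h (circ e.1 e.2 t).
have /compact_near_coveringP cpt := @segment_compact R (d / 2) d.
have : filter_prod (nbhs e1) (nbhs e2)
    (fun p => `[d / 2, d]%classic `<=` P p).
  apply: (cpt _ (filter_prod (nbhs e1) (nbhs e2)) P _) => b; rewrite /= in_itv /= => bd.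
  have [t bt] : exists t, h (circ e1 e2 (t + b)) != h (circ e1 e2 t).
    apply: contrapT => nb; apply: nd; exists b => // t.
    by apply/eqP/negPn/negP => bt; apply: nb; exists t.
  pose G (q : R * ('rV[R]_n * 'rV[R]_n)) :=
    h (circ q.2.1 q.2.2 (t + q.1)) - h (circ q.2.1 q.2.2 t).
  have FF : Filter (filter_prod (nbhs b) (filter_prod (nbhs e1) (nbhs e2))).
    exact: filter_prod_filter.
  have G0 : G @ filter_prod (nbhs b) (filter_prod (nbhs e1) (nbhs e2)) -->
      h (circ e1 e2 (t + b)) - h (circ e1 e2 t).
    have c1 : q.2.1 @[q --> filter_prod (nbhs b)
        (filter_prod (nbhs e1) (nbhs e2))] --> e1.
      exact: (cvg_comp snd fst cvg_snd cvg_fst).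
    have c2 : q.2.2 @[q --> filter_prod (nbhs b)
        (filter_prod (nbhs e1) (nbhs e2))] --> e2.
      exact: (cvg_comp snd snd cvg_snd cvg_snd).
    apply: cvgB; apply: (continuous_cvg _ (@ch _)); apply: cvg_circ => //.
    - by apply: cvgD; [exact: cvg_cst|exact: cvg_fst].
    - exact: cvg_cst.
  rewrite -subr_eq0 in bt.
  have : \forall q \near filter_prod (nbhs b) (filter_prod (nbhs e1) (nbhs e2)),
      G q != 0.
    exact: (cvgr_neq0 _ G0 bt).
  apply: filterS => -[c [x y]] /= Gq; exists t.
  by rewrite -subr_eq0.
apply: filterS => p sub [b bd pb]; have [|t] := sub b; first by rewrite /= in_itv.
by have /= -> := pb t; rewrite eqxx.
Qed.

End Circles.

(** * Local constancy along great circles *)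

Section GreatCircles.
Variables (R : realType) (n : nat).
Implicit Types (x y z e u v : 'rV[R]_n) (a s t b : R).

(** Here [u] plays the cross product of [x] and [z]. The coefficient [p] fixes both inner products
    at [c]; since [p *: (x + z)] has squared length [2 p^2 (1 + k) = 2 c p], the tilt by [q] must
    supply the remaining [1 - 2 c p]. *)
Lemma tilted_bisector x z u (k c p q : R) :
  dot x x = 1 -> dot z z = 1 -> dot x z = k ->
  dot u x = 0 -> dot u z = 0 -> dot u u = 1 - k ^+ 2 ->
  p * (1 + k) = c -> q ^+ 2 * (1 - k ^+ 2) = 1 - 2 * c * p ->
  let y := p *: (x + z) + q *: u in
  [/\ dot x y = c, dot z y = c & dot y y = 1].
Proof.
move=> xx zz xz ux uz uu pc qc y.
have xy : dot x y = c by rewrite /y !(dotDr, dotZr) xx xz (dotC x u) ux; lra.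
have zy : dot z y = c.
  by rewrite /y !(dotDr, dotZr) zz (dotC z x) xz (dotC z u) uz; lra.
have uy : dot u y = q * (1 - k ^+ 2).
  by rewrite /y !(dotDr, dotZr) ux uz uu; lra.
by split=> //; rewrite {1}/y !(dotDl, dotZl) xy zy uy; lra.
Qed.

(* For t small, z = circ e1 e3 t is joined to every x = circ e1 e2 a close to e1
   through a point at angular distance b from both and close to circ e1 e2 b:
   it is the bisector of x and z tilted by a multiple of their cross product. *)
Lemma circ_near_cst T (h : 'rV[R]_n -> T) e1 e2 b : (3 <= n)%N ->
  orthonormal2 e1 e2 -> 0 < b < pi ->
  (\forall u \near e1 & v \near circ e1 e2 b,
     dot u u = 1 -> dot v v = 1 -> dot u v = cos b -> h u = h v) ->
  \forall a \near (0 : R), h (circ e1 e2 a) = h e1.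
Proof.
move=> n3 [e11 e22 e12] b0 [/= [U V] /= [nU nV] UV].
have [e3 [e33 e13 e23]] := dim3_orthogonal e1 e2 n3.
have sb : 0 < sin b by exact: sin_gt0_pi.
set c := cos b; have cs : 1 - c ^+ 2 = sin b ^+ 2 by have := cos2Dsin2 b; rewrite -/c; lra.
(* The squared length left for the tilt when the two points to be joined have inner product [k]. *)
pose A k := 1 - 2 * c ^+ 2 / (1 + k).
have A1 : A 1 = sin b ^+ 2 by rewrite /A -cs (_ : 1 + 1 = 2 :> R); lra.
have cvgA (f : R -> R) s l : f x @[x --> s] --> l -> 1 + l != 0 ->
    A (f x) @[x --> s] --> A l.
  move=> fl l0; apply: cvgB; first exact: cvg_cst.
  apply: cvgM; first exact: cvg_cst.
  by apply: cvgV => //; apply: cvgD => //; exact: cvg_cst.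
(* The joining point for [e1] and [circ e1 e3 t], whose normalised cross product is [e2]. With [e2]
   written in, the formula still makes sense at [t = 0], where the cross product vanishes. *)
pose Y0 t := (c / (1 + cos t)) *: (e1 + circ e1 e3 t) + Num.sqrt (A (cos t)) *: e2.
have cosc t : cos x @[x --> t] --> cos t by exact: continuous_cos.
have sqc t : Num.sqrt x @[x --> t] --> Num.sqrt t by exact: sqrt_continuous.
have Y00 : Y0 0 = circ e1 e2 b.
  rewrite /Y0 circ0 cos0 A1 (_ : 1 + 1 = 2 :> R); last by lra.
  rewrite sqrtr_sqr ger0_norm ?ltW // -[e1 + e1]mulr2n -[e1 *+ 2]scaler_nat scalerA.
  by rewrite divfK ?pnatr_eq0.
have cY0 : Y0 t @[t --> 0] --> Y0 0.
  apply: cvgD; apply: cvgZ.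
  - apply: cvgM; first exact: cvg_cst.
    apply: cvgV; first by rewrite cos0; lra.
    by apply: cvgD; [exact: cvg_cst|exact: cosc].
  - by apply: cvgD; [exact: cvg_cst|exact: continuous_circ].
  - apply: (continuous_cvg _ (sqc _)); apply: (cvgA cos) => //.
    by rewrite cos0; lra.
  - exact: cvg_cst.
have A0 : 0 < A (cos 0) by rewrite cos0 A1 exprn_gt0.
have cA0 : A (cos t) @[t --> 0] --> A (cos 0).
  by apply: (cvgA cos) => //; rewrite cos0; lra.
(* First [t] is fixed, positive so that [z] lies off the circle and the cross product is nonzero;
   only then does [a] tend to 0. *)
have [t [t0 At zU YV]] : exists t, [/\ 0 < t < pi, 0 < A (cos t),
    U (circ e1 e3 t) & \forall y \near Y0 t, V y].
  have : \forall t \near 0^'+, [/\ 0 < t < pi, 0 < A (cos t),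
      U (circ e1 e3 t) & \forall y \near Y0 t, V y].
    near=> t; split.
    - by apply/andP; split; near: t; [exact: nbhs_right_gt|exact: nbhs_right_lt (pi_gt0 R)].
    - near: t; apply: cvg_within.
      exact: (cvgr_gt _ cA0 _ A0).
    - near: t; apply: cvg_within.
      by apply: continuous_circ; rewrite circ0.
    - near: t; apply: cvg_within; apply: (cY0 V°); rewrite Y00.
      exact: nbhs_interior.
  by move=> /filter_ex.
have st : 0 < sin t by exact: sin_gt0_pi.
(* [k a] is the inner product of [circ e1 e2 a] and [z]. [N a] is the cross product of [z] and
   [circ e1 e2 a] in the frame [e1, e2, e3], and [w a] is its length. *)
pose k a := cos t * cos a.
pose w a := Num.sqrt (1 - k a ^+ 2).
pose z := circ e1 e3 t.
pose N a := (- (sin t * sin a)) *: e1 + (sin t * cos a) *: e2 + (cos t * sin a) *: e3.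
pose Y a := (c / (1 + k a)) *: (circ e1 e2 a + z)
  + (Num.sqrt (A (k a)) / w a) *: N a.
have k0 : k 0 = cos t by rewrite /k cos0 mulr1.
have w0 : w 0 = sin t by rewrite /w k0 -sin2cos2 sqrtr_sqr ger0_norm ?ltW.
have Y0E : Y 0 = Y0 t.
  rewrite /Y /Y0 k0 w0 circ0 /N sin0 cos0 !mulr0 oppr0 !scale0r add0r addr0.
  by rewrite scalerA mulr1 divfK ?gt_eqF.
have kt1 : 1 + k 0 != 0.
  have := cos2Dsin2 t; rewrite k0 => tt; apply/eqP => kt.
  by have : 0 < sin t ^+ 2 by [rewrite exprn_gt0]; nra.
have ck : k a @[a --> 0] --> k 0 by apply: cvgM; [exact: cvg_cst|exact: cosc].
have cY : Y a @[a --> 0] --> Y 0.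
  have csin : sin x @[x --> (0 : R)] --> sin 0 by exact: continuous_sin.
  apply: cvgD; apply: cvgZ.
  - apply: cvgM; first exact: cvg_cst.
    apply: cvgV => //.
    by apply: cvgD; [exact: cvg_cst|exact: ck].
  - by apply: cvgD; [exact: continuous_circ|exact: cvg_cst].
  - apply: cvgM; first by apply: (continuous_cvg _ (sqc _)); exact: cvgA.
    apply: cvgV; first by rewrite w0 gt_eqF.
    apply: (continuous_cvg _ (sqc _)); apply: cvgB; first exact: cvg_cst.
    exact: cvgM.
  - apply: cvgD; first apply: cvgD; apply: cvgZ; try exact: cvg_cst.
    + by apply: cvgN; apply: cvgM; [exact: cvg_cst|].
    + by apply: cvgM; [exact: cvg_cst|exact: cosc].
    + by apply: cvgM; [exact: cvg_cst|].
have key a : U (circ e1 e2 a) -> V (Y a) -> 0 < A (k a) ->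
    h (circ e1 e2 a) = h z.
  move=> Ua Va Aa; have aa := cos2Dsin2 a; have tt := cos2Dsin2 t.
  have w2 : 0 < 1 - k a ^+ 2.
    have : 0 < sin t ^+ 2 by rewrite exprn_gt0.
    have := sqr_ge0 (sin a); rewrite /k; nra.
  have kk : 1 + k a != 0 by apply/eqP => kk; nra.
  have xx : dot (circ e1 e2 a) (circ e1 e2 a) = 1.
    by rewrite /circ !dotE (dotC e2 e1) e11 e22 e12; lra.
  have zz : dot z z = 1 by rewrite /z /circ !dotE (dotC e3 e1) e11 e33 e13; lra.
  have xz : dot (circ e1 e2 a) z = k a.
    by rewrite /z /circ /k !dotE (dotC e2 e1) e11 e12 e13 e23; lra.
  have Nx : dot (N a) (circ e1 e2 a) = 0.
    rewrite /N /circ !dotE (dotC e2 e1) (dotC e3 e1) (dotC e3 e2).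
    by rewrite e11 e22 e12 e13 e23; lra.
  have Nz : dot (N a) z = 0.
    by rewrite /N /z /circ !dotE (dotC e2 e1) (dotC e3 e1) e11 e33 e12 e13 e23; lra.
  have NN : dot (N a) (N a) = 1 - k a ^+ 2.
    have -> : 1 - k a ^+ 2 = (sin t ^+ 2) * (cos a ^+ 2 + sin a ^+ 2)
        + cos t ^+ 2 * sin a ^+ 2 by rewrite /k; nra.
    rewrite /N !dotE (dotC e2 e1) (dotC e3 e1) (dotC e3 e2) e11 e22 e33 e12 e13 e23.
    by lra.
  have qq : (Num.sqrt (A (k a)) / w a) ^+ 2 * (1 - k a ^+ 2) = A (k a).
    by rewrite exprMn exprVn !sqr_sqrtr ?ltW // divfK ?gt_eqF.
  have pk : c / (1 + k a) * (1 + k a) = c by rewrite divfK.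
  have AE : A (k a) = 1 - 2 * c * (c / (1 + k a)) by rewrite /A; lra.
  have [Yx Yz YY] := tilted_bisector xx zz xz Nx Nz NN pk (etrans qq AE).
  have -> := UV (circ e1 e2 a, Y a) (conj Ua Va) xx YY Yx.
  by have <- := UV (z, Y a) (conj zU Va) zz YY Yz.
have near_key : \forall a \near (0 : R), h (circ e1 e2 a) = h z.
  near=> a; apply: key; near: a.
  - by apply: continuous_circ; rewrite circ0.
  - by apply: cY; rewrite Y0E.
  - by apply: (cvgr_gt _ (cvgA _ _ _ ck kt1)); rewrite k0.
(* The value [a = 0] is allowed too, so [e1] and its neighbours on the circle are all joined to the
   same [z]. *)
have e1z : h e1 = h z by have /nbhs_singleton := near_key; rewrite circ0.
by rewrite e1z.
Unshelve. all: by end_near.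
Qed.

Lemma has_period_near_shift (f : R -> R) s b :
  has_period_near (fun t => f (s + t)) b -> has_period_near f b.
Proof.
move=> [c cb fc]; exists c => // t.
by have := fc (t - s); rewrite addrA subrKC.
Qed.

(** Unit vectors [u], [v] at angular distance [b] determine by Gram-Schmidt a frame [(u, g)] with
    [v = circ u g b]. It depends continuously on [(u, v)], so it is close to [(e1, e2)], and the
    period [b] at angle 0 gives [h u = h v]. *)
Lemma near_circ_period (h : 'rV[R]_n -> R) e1 e2 b : orthonormal2 e1 e2 ->
  0 < b < pi ->
  (\forall x \near e1 & y \near e2,
     orthonormal2 x y -> periodic (h \o circ x y) b) ->
  \forall u \near e1 & v \near circ e1 e2 b,
     dot u u = 1 -> dot v v = 1 -> dot u v = cos b -> h u = h v.
Proof.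
move=> [e11 e22 e12] b0 per; have sb : 0 < sin b by exact: sin_gt0_pi.
pose g (q : 'rV[R]_n * 'rV[R]_n) := (sin b)^-1 *: (q.2 - cos b *: q.1).
set F := filter_prod (nbhs e1) (nbhs (circ e1 e2 b)).
have cg : g @ F --> e2.
  have -> : e2 = (sin b)^-1 *: (circ e1 e2 b - cos b *: e1).
    by rewrite /circ addrC addKr scalerA mulVf ?scale1r ?gt_eqF.
  apply: cvgZl_tmp; apply: cvgB; first exact: cvg_snd.
  by apply: cvgZl_tmp; exact: cvg_fst.
have perF : F (fun q => orthonormal2 q.1 (g q) ->
    periodic (h \o circ q.1 (g q)) b).
  exact: cvg_pair cvg_fst cg _ per.
apply: filterS perF => -[u v] /= pv uu vv uv.
have gE : sin b *: g (u, v) = v - cos b *: u.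
  by rewrite scalerA mulfV ?scale1r // gt_eqF.
have ug : dot u (g (u, v)) = 0 by rewrite /g !dotE uu uv mulr1 subrr mulr0.
have gg : dot (g (u, v)) (g (u, v)) = 1.
  have ss : sin b * sin b = 1 - cos b ^+ 2 by rewrite -sin2cos2 expr2.
  apply: (mulfI (lt0r_neq0 sb)); apply: (mulfI (lt0r_neq0 sb)).
  rewrite -dotZr -dotZl gE !dotE (dotC v u) uu vv uv !mulr1 ss; lra.
have := pv (And3 uu gg ug) 0; rewrite /= add0r circ0 => <-.
by rewrite /circ gE addrC subrK.
Qed.

Theorem great_circle_cst (h : 'rV[R]_n -> R) : (3 <= n)%N -> continuous h ->
  (forall x, h (- x) = h x) ->
  (forall e1 e2, orthonormal2 e1 e2 ->
     exists2 b, sin b != 0 & periodic (h \o circ e1 e2) b) ->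
  forall e1 e2 t, orthonormal2 e1 e2 -> h (circ e1 e2 t) = h e1.
Proof.
move=> n3 ch heven hper; have pi0 := pi_gt0 R.
have perpi e1 e2 : periodic (h \o circ e1 e2) pi.
  by move=> t; rewrite /= circDpi heven.
have chc e1 e2 : continuous (h \o circ e1 e2).
  by move=> t; apply: continuous_comp; [exact: continuous_circ|exact: ch].
(* [bad k] speaks only of the failure at [k + 1]. For the least bad [k], every circle has a period
   near [pi / k]: by minimality if [k > 2], by [hper] if [k = 2]. *)
pose bad k := `[< (2 <= k)%N /\ exists e1 e2, orthonormal2 e1 e2 /\
  ~ has_period_near (h \o circ e1 e2) (pi / k.+1%:R) >].
suff nbad : ~ exists k, bad k.
  move=> e1 e2 t e12.
  suff hk k : (2 <= k)%N -> has_period_near (h \o circ e1 e2) (pi / k%:R).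
    by have /= := small_periods_cst (chc e1 e2) hk t; rewrite circ0.
  case: k => [//|[//|[|k]]] _.
    by have [b sb hb] := hper _ _ e12; exact: periodic_pi_half hb sb.
  apply: contrapT => nk; apply: nbad; exists k.+2; apply/asboolP; split => //.
  by exists e1, e2.
move=> ex; have [k /asboolP[k2 [e1 [e2 [e12 nk]]]] kmin] := ex_minnP ex.
have good x y : orthonormal2 x y -> has_period_near (h \o circ x y) (pi / k%:R).
  move=> xy; case: k k2 {nk} kmin => [//|[//|[|k]]] _ kmin.
    by have [b sb hb] := hper _ _ xy; exact: periodic_pi_half hb sb.
  apply: contrapT => nk; suff /kmin : bad k.+2 by rewrite ltnn.
  by apply/asboolP; split => //; exists x, y.
have kR : 2 <= k%:R :> R by rewrite ler_nat.
have b0 : 0 < (pi : R) / k%:R < pi.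
  apply/andP; split; first by apply: divr_gt0; lra.
  by rewrite ltr_pdivrMr; nra.
have loc s : \forall a \near 0, h (circ e1 e2 (s + a)) = h (circ e1 e2 s).
  have fs := circ_orthonormal2 s e12.
  set f1 := circ e1 e2 s in fs *; set f2 := circ e1 e2 (s + pi / 2) in fs.
  have nf : ~ has_period_near (h \o circ f1 f2) (pi / k.+1%:R).
    move=> hp; apply: nk; apply: (@has_period_near_shift _ s).
    rewrite (_ : (fun _ => _) = h \o circ f1 f2) // funeqE => t /=.
    by rewrite circD.
  have := circ_near_cst n3 fs b0 (near_circ_period fs b0 _).
  move=> /(_ h)/=.
  have nper : \forall x \near f1 & y \near f2,
      orthonormal2 x y -> periodic (h \o circ x y) (pi / k%:R).
    apply: filterS (near_no_period ch nf) => -[x y] /= nxy xy.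
    by apply: periodic_pi_div => //; [exact: ltnW|exact: good].
  move=> /(_ nper); apply: filterS => a <-.
  by rewrite circD.
(* A locally constant function has zero derivative everywhere, hence is constant. It then has every
   period, contradicting [nk]. *)
have hcst s t : h (circ e1 e2 s) = h (circ e1 e2 t).
  apply: (@is_derive_0_is_cst R (h \o circ e1 e2)) => x.
  apply: (near_eq_is_derive _ (is_derive_cst (h (circ e1 e2 x)) x 1)).
  have := loc x; rewrite (near_shift x 0) /=.
  by apply: filterS => a /=; rewrite sub0r subrKC => ->.
apply: nk; exists (pi / k.+1%:R); last by move=> t; exact: hcst.
have : 0 < (pi : R) / k.+1%:R by apply: divr_gt0.
by move: (pi / _) => d d0; apply/andP; split; lra.
Qed.

End GreatCircles.

(** * Support functions *)

Section SupportFunction.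
Variables (R : realType) (n : nat).
Implicit Types (K : set 'rV[R]_n) (x y u v : 'rV[R]_n) (r c l : R).

Lemma coord_le_norm x (i : 'I_n) : `|x 0 i| <= `|x|.
Proof.
rewrite [`|x|]mx_normrE.
exact: (le_bigmax _ (fun ij : 'I_1 * 'I_n => `|x ij.1 ij.2|) (0, i)).
Qed.

Lemma dot_le_norm x y : `|dot x y| <= n%:R * (`|x| * `|y|).
Proof.
apply: (le_trans (ler_norm_sum _ _ _)).
have -> : n%:R * (`|x| * `|y|) = \sum_(i < n) `|x| * `|y|.
  by rewrite sumr_const card_ord mulr_natl.
by apply: ler_sum => i _; rewrite normrM ler_pM // coord_le_norm.
Qed.

Lemma continuous_sumr (T : topologicalType) (I : Type) (s : seq I)
    (f : I -> T -> R) : (forall i, continuous (f i)) ->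
  continuous (fun p => \sum_(i <- s) f i p).
Proof.
move=> cf; elim: s => [|i s IHs] p.
  by under eq_fun do rewrite big_nil; exact: cvg_cst.
under eq_fun do rewrite big_cons.
by apply: cvgD; [exact: cf|exact: IHs].
Qed.

Lemma continuous_dot u : continuous (fun x => dot x u).
Proof.
apply: continuous_sumr => i x.
by apply: continuousM; [exact: coord_continuous|exact: cst_continuous].
Qed.

Lemma continuous_dot_sqr : continuous (fun x => dot x x).
Proof.
by apply: continuous_sumr => i x; apply: continuousM; exact: coord_continuous.
Qed.

Definition supp K u := sup [set dot x u | x in K].

Lemma suppP K u : compact K -> K !=set0 ->
  (exists2 x, K x & dot x u = supp K u) /\
  (forall x, K x -> dot x u <= supp K u).
Proof.
move=> cK K0; have [x /set_mem Kx xmax] : exists2 x, x \in K &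
    forall y, y \in K -> dot y u <= dot x u.
  apply: compact_EVT_max => //; apply: continuous_subspaceT.
  exact: continuous_dot.
have supE : supp K u = dot x u.
  apply/eqP; rewrite eq_le; apply/andP; split.
    apply: ge_sup; first by exists (dot x u), x.
    by move=> _ [y Ky <-]; apply: xmax; exact: mem_set.
  apply: ub_le_sup; last by exists x.
  by exists (dot x u) => _ [y Ky <-]; apply: xmax; exact: mem_set.
split; first by exists x.
by move=> y Ky; rewrite supE; apply: xmax; exact: mem_set.
Qed.

(** If [B] bounds the sup norm on [K], then [supp K] is Lipschitz with constant [n B]. *)
Lemma continuous_supp K : compact K -> K !=set0 -> continuous (supp K).
Proof.
move=> cK K0 u; apply/(@cvgrPdist_le _ _ _ (nbhs u)) => e e0.
have [M [_ MP]] := compact_bounded cK.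
pose B := `|M| + 1.
have KB x : K x -> `|x| <= B.
  by apply: MP; rewrite /B (le_lt_trans (ler_norm M)) // ltrDl.
have c0 : 0 < n%:R * B + 1.
  by rewrite ltr_wpDl // mulr_ge0 // /B addr_ge0.
have suppB a b : supp K a <= supp K b + n%:R * (B * `|a - b|).
  have [[x Kx <-] _] := suppP a cK K0; have [_ /(_ _ Kx) xb] := suppP b cK K0.
  rewrite -{1}(subrKC b a) dotDr lerD //.
  apply: (le_trans (ler_norm _)); apply: (le_trans (dot_le_norm _ _)).
  by rewrite ler_wpM2l // ler_wpM2r // KB.
apply/nbhs_ballP; exists (e / (n%:R * B + 1)); first exact: divr_gt0.
move=> v /=; rewrite -ball_normE /= => /ltW uv.
have {}uv : n%:R * (B * `|u - v|) <= e.
  rewrite mulrA; apply: (le_trans (ler_pM _ _ (_ : _ <= n%:R * B + 1) uv)) => //.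
  - by rewrite mulr_ge0 // addr_ge0.
  - by rewrite lerDl.
  - by rewrite mulrC divfK ?gt_eqF.
have := suppB u v; have := suppB v u; rewrite (distrC v u) => h1 h2.
by rewrite ler_norml; apply/andP; split; lra.
Qed.

Lemma convex_setP K x y l : convex_set K -> K x -> K y -> 0 <= l <= 1 ->
  K (l *: x + (1 - l) *: y).
Proof.
move=> cK Kx Ky l01.
by have /set_mem := cK x y (Itv01 (andP l01).1 (andP l01).2) (mem_set Kx) (mem_set Ky).
Qed.

Lemma interior_width K u : K° !=set0 -> u != 0 ->
  exists x y, [/\ K x, K y & dot x u < dot y u].
Proof.
move=> [p Kp] /dot_gt0 u0; exists p.
have cp : p + t *: u @[t --> (0 : R)] --> p.
  rewrite -{2}(addr0 p) -(scale0r u); apply: cvgD; first exact: cvg_cst.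
  by apply: cvgZ; [exact: cvg_id|exact: cvg_cst].
have : \forall t \near (0 : R)^'+, 0 < t /\ K (p + t *: u).
  near=> t; split; first by near: t; exact: nbhs_right_gt.
  by near: t; apply: cvg_within; exact: cp Kp.
move=> /filter_ex[t [t0 Kt]]; exists (p + t *: u); split => //.
  exact: nbhs_singleton.
by rewrite dotDl dotZl ltrDl mulr_gt0.
Unshelve. all: by end_near.
Qed.

(** The minimised function is the squared Euclidean distance to [y] up to the constant [dot y y]. At
    a minimum, moving towards another point [z] of [K] cannot decrease it. *)
Lemma closest_point K y : compact K -> convex_set K -> K !=set0 ->
  exists2 x, K x & forall z, K z -> dot (z - x) (y - x) <= 0.
Proof.
move=> cK convK K0.
have [x /set_mem Kx xmin] : exists2 x, x \in K & forall z, z \in K ->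
    dot x x - 2 * dot x y <= dot z z - 2 * dot z y.
  apply: compact_EVT_min => //; apply: continuous_subspaceT => z.
  apply: (@cvgB _ _ _ (nbhs z)); first exact: continuous_dot_sqr.
  by apply: (@cvgMl_tmp _ _ (nbhs z)); exact: continuous_dot.
exists x => // z Kz; rewrite leNgt; apply/negP => a0.
set a := dot (z - x) (y - x) in a0; pose b := dot (z - x) (z - x).
have b0 : 0 <= b := dot_ge0 _.
(* Moving by the fraction [l] lowers the function by [l (2 a - l b)]. This choice keeps [l] at most
   1 and gives [l b < 2 a], so the decrease is strict. *)
pose l := a / (a + b).
have ab : 0 < a + b by lra.
have l01 : 0 <= l <= 1.
  by rewrite /l divr_ge0 ?(ltW a0) ?(ltW ab) // ler_pdivrMr // mul1r; lra.
have l0 : 0 < l by rewrite divr_gt0.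
have := xmin _ (mem_set (convex_setP convK Kz Kx l01)).
have -> : l *: z + (1 - l) *: x = x + l *: (z - x).
  by rewrite scalerBl scale1r scalerBr addrCA.
rewrite leNgt => /negP; apply.
have -> : dot (x + l *: (z - x)) (x + l *: (z - x)) - 2 * dot (x + l *: (z - x)) y
    = dot x x - 2 * dot x y - l * (2 * a - l * b).
  by rewrite /a /b !dotE !(dotC x z); lra.
rewrite ltrBlDr ltrDl mulr_gt0 //.
have lab : l * (a + b) = a by rewrite /l divfK ?gt_eqF.
nra.
Qed.

Lemma supp_cst_ball K r : convex_body K -> (0 < n)%N ->
  (forall u, dot u u = 1 -> supp K u = r) ->
  0 < r /\ K = [set x | enorm x <= r].
Proof.
move=> [cK convK Kint] n0 hr.
have K0 : K !=set0 by have [p /nbhs_singleton Kp] := Kint; exists p.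
(* The width of [K] in a unit direction is [2 r], and it is positive because [K] has interior. *)
have r0 : 0 < r.
  pose u : 'rV[R]_n := delta_mx 0 (Ordinal n0).
  have u1 : dot u u = 1.
    rewrite /dot (bigD1 (Ordinal n0)) //= !mxE !eqxx mulr1 big1 ?addr0 // => i i0.
    by rewrite !mxE (negPf i0) andbF mulr0.
  have u0 : u != 0 by rewrite -dot_eq0 u1 oner_neq0.
  have [x [y [Kx Ky xy]]] := interior_width Kint u0.
  have [_ /(_ _ Ky)] := suppP u cK K0.
  have [_ /(_ _ Kx)] := suppP (- u) cK K0.
  by rewrite !hr ?dotNr ?dotNl ?opprK //; lra.
have sq0 x : 0 <= enorm x by exact: sqrtr_ge0.
have hunit u : u != 0 ->
    exists2 a, 0 < a & supp K (a *: u) = r /\ dot (a *: u) (a *: u) = 1.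
  move=> u0; have [a a0 au] := normalize_dot u0.
  by exists a => //; split => //; exact: hr.
split => //; rewrite eqEsubset; split => y /= hy.
  have [->|y0] := eqVneq y 0; first by rewrite /enorm dot0l sqrtr0 ltW.
  have [a a0 [ay ayy]] := hunit y y0.
  have [_ /(_ _ hy)] := suppP (a *: y) cK K0.
  rewrite ay dotZr -enorm_sqr => ayr.
  have aE : a * enorm y = 1.
    apply/eqP; rewrite -(eqrXn2 (n := 2)) ?mulr_ge0 ?(ltW a0) //.
    by rewrite exprMn enorm_sqr expr1n -ayy !dotE expr2 mulrA.
  by move: ayr; rewrite expr2 mulrA aE mul1r.
(* If [y] were outside [K], then for the unit vector [u] from [x] towards [y] the chain
   [r <= dot x u < dot y u <= r] would be contradictory. *)
have [x Kx xz] := closest_point y cK convK K0.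
suff /eqP -> : y == x by [].
rewrite -subr_eq0; apply/negPn/negP => yx.
have [a a0 [ar auu]] := hunit _ yx; set u := a *: (y - x) in ar auu.
have [[z Kz]] := suppP u cK K0; rewrite ar => zr _.
have xr : r <= dot x u.
  by have := xz z Kz; rewrite -(pmulr_rle0 _ a0) -dotZr -/u dotDl dotNl zr; lra.
have pos : 0 < dot (y - x) u by rewrite dotZr mulr_gt0 // dot_gt0.
clearbody u.
(* 0 <= |y - r u|^2 with |y| <= r bounds the component of y along u by r. *)
have yr : dot y u <= r.
  have := dot_ge0 (y - r *: u); rewrite !dotE auu (dotC u y).
  have : dot y y <= r ^+ 2 by rewrite -enorm_sqr ler_sqr ?nnegrE // ltW.
  by move=> h1 h2; rewrite -(ler_pM2l r0); nra.
by move: pos; rewrite dotDl dotNl; lra.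
Qed.

End SupportFunction.

(** * Projections onto lines *)

Section Lines.
Variables (R : realType).

(** The recursion starts from the Dirac measure at the empty tuple, so integrating over that factor
    just evaluates the section there. *)
Lemma lebesgue_tuple1 (A : set (1.-tuple (measurableTypeR R))) :
  measurable A ->
  lebesgue_tuple R 1 A = pushforward lebesgue_measure (fun x : R => [tuple x]) A.
Proof.
move=> mA; rewrite /= /lebesgue_cons /pushforward /product_measure1.
set B := (X in xsection X).
have mB : measurable B.
  by rewrite -[B]setTI; exact: (measurable_tuple_cons (k := 0)).
rewrite integral_dirac //; last exact: measurable_fun_xsection.
rewrite diracT mul1e /=; congr lebesgue_measure.
apply/seteqP; split => x /=; rewrite /xsection /= inE /B /=.
  by rewrite (_ : [tuple x] = cons_tuple x [tuple]) //; exact: val_inj.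
by rewrite (_ : [tuple x] = cons_tuple x [tuple]) //; exact: val_inj.
Qed.

(** Keeping [k] a variable allows [k] to be the dimension of a line, which equals 1 only
    propositionally; the sum then stands for the single coordinate. *)
Lemma integral_lebesgue_tuple1 k (a b c : R) : k = 1%N -> a < b ->
  (\int[lebesgue_tuple R k]_(t in [set t : k.-tuple (measurableTypeR R) |
      (a <= \sum_i tnth t i <= b)%R]) ((\sum_i tnth t i) * c)%:E =
   (c * (b ^+ 2 - a ^+ 2) / 2)%:E)%E.
Proof.
move=> -> ab.
have mt : measurable_fun setT (fun x : R => [tuple x] : 1.-tuple (measurableTypeR R)).
  rewrite (_ : (fun _ => _) = (fun x => cons_tuple x [tuple])).
    by apply: measurable_cons; [exact: measurable_id|exact: measurable_cst].
  by apply/funext => x; exact: val_inj.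
rewrite (@eq_measure_integral _ _ _ _ (pushforward lebesgue_measure
    (fun x : R => [tuple x] : 1.-tuple (measurableTypeR R)))); last first.
  by move=> A mA _; exact: lebesgue_tuple1.
have sum1 (t : 1.-tuple (measurableTypeR R)) : \sum_i tnth t i = tnth t ord0.
  by rewrite big_ord1.
have msum : measurable_fun setT
    (fun t : 1.-tuple (measurableTypeR R) => \sum_i tnth t i).
  under eq_fun do rewrite sum1; exact: measurable_tnth.
have preE : (fun x : R => [tuple x] : 1.-tuple (measurableTypeR R)) @^-1`
    [set t | a <= \sum_i tnth t i <= b] = `[a, b]%classic.
  by apply/seteqP; split => x /=; rewrite sum1 (tnth_nth 0) in_itv.
have cf : continuous (fun x : R => x * c).
  by move=> x; apply: cvgM; [exact: cvg_id|exact: cvg_cst].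
pose F x := c / 2 * x ^+ 2.
have dF (x : R) : is_derive x 1 F (x * c).
  apply: is_derive_eq.
  by rewrite -![_ *: _]/(_ * _); lra.
have cF : continuous F.
  by move=> x; apply/differentiable_continuous/derivable1_diffP; exact: ex_derive.
have mD : measurable [set t : 1.-tuple (measurableTypeR R) |
    a <= \sum_i tnth t i <= b].
  rewrite (_ : [set _ | _] = setT `&`
      (fun t : 1.-tuple (measurableTypeR R) => \sum_i tnth t i) @^-1` `[a, b]).
    exact: msum.
  by rewrite setTI; apply/seteqP; split => t /=; rewrite in_itv.
rewrite integral_pushforward //.
- rewrite preE /comp.
  under eq_integral do rewrite sum1 (tnth_nth 0) /=.
  rewrite (@continuous_FTC2 R _ F) //.
  + by rewrite -EFinB; congr EFin; rewrite /F; lra.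
  + exact: continuous_subspaceT.
  + split; first by move=> x _; exact: ex_derive.
      by apply: cvg_at_right_filter; exact: cF.
    by apply: cvg_at_left_filter; exact: cF.
  + by move=> x _; rewrite derive1E derive_val.
- by apply/measurable_EFinP; apply: measurable_funM => //; exact: measurable_cst.
- rewrite preE /comp.
  apply: (@eq_integrable _ _ _ lebesgue_measure _ _ (EFin \o (fun x : R => x * c))) => //.
    by move=> x _; rewrite /= sum1 (tnth_nth 0).
  apply: continuous_compact_integrable; first exact: segment_compact.
  exact: continuous_subspaceT.
Qed.


Variable n : nat.
Implicit Types (K : set 'rV[R]_n) (u x : 'rV[R]_n).

Lemma suppZ K u a : compact K -> K !=set0 -> 0 < a ->
  supp K (a *: u) = a * supp K u.
Proof.
move=> cK K0 a0; have [[x Kx xu] ux] := suppP u cK K0.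
have [[y Ky <-] yu] := suppP (a *: u) cK K0.
apply/eqP; rewrite eq_le dotZr ler_pM2l // ux //=.
by rewrite -dotZr -xu -dotZr yu.
Qed.

Lemma projection_line K u c : convex_body K -> dot u u = 1 ->
  (exists2 x, K x & dot x u = c) <-> - supp K (- u) <= c <= supp K u.
Proof.
move=> [cK convK Kint] uu.
have K0 : K !=set0 by have [p /nbhs_singleton Kp] := Kint; exists p.
have [[y Ky yu] uy] := suppP u cK K0; have [[x Kx xu] ux] := suppP (- u) cK K0.
split=> [[z Kz <-]|/andP[xc cy]].
  by rewrite uy // andbT; have := ux z Kz; rewrite dotNr; lra.
rewrite -xu -yu dotNr opprK in xc cy.
have [xy|xy] := eqVneq (dot x u) (dot y u); first by exists x => //; lra.
have d0 : 0 < dot y u - dot x u by lra.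
pose l := (c - dot x u) / (dot y u - dot x u).
exists (l *: y + (1 - l) *: x).
  apply: convex_setP => //; rewrite ler_pdivrMr // mul1r.
  by apply/andP; split; [apply: divr_ge0; lra|lra].
have : l * (dot y u - dot x u) = c - dot x u by rewrite divfK // gt_eqF.
by rewrite !dotE; lra.
Qed.

(** The projection is the segment from [- supp K (- u)] to [supp K u], whose first moment is
    proportional to the difference of the squared endpoints. The endpoints are distinct, so they are
    opposite. *)
Lemma centroid_line K u : convex_body K -> dot u u = 1 ->
  centroid_at_origin (orthogonal_projection <[u]>%VS K) ->
  supp K (- u) = supp K u.
Proof.
move=> bK uu cent; have [cK convK Kint] := bK.
have K0 : K !=set0 by have [p /nbhs_singleton Kp] := Kint; exists p.
have u0 : u != 0 by rewrite -dot_eq0 uu oner_neq0.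
have dim1 : \dim <[u]>%VS = 1%N by rewrite dim_vline u0.
pose w : subvs_of <[u]>%VS := Subvs (memv_line u).
pose b : (\dim <[u]>%VS).-tuple (subvs_of <[u]>%VS) := nseq_tuple _ w.
have coordE t : vsval (of_coords b t) = (\sum_i tnth t i) *: u.
  rewrite scaler_suml linear_sum; apply: eq_bigr => i _.
  by rewrite linearZ /= tnth_nseq.
have ob : orthonormal_basis b.
  move=> i j; rewrite !tnth_nseq /= uu.
  rewrite (_ : i = j) ?eqxx //; apply: val_inj; case: i j => i + [j +] /=.
  by rewrite dim1 !ltnS !leqn0 => /eqP -> /eqP ->.
have ab : - supp K (- u) < supp K u.
  have [x [y [Kx Ky xy]]] := interior_width Kint u0.
  have [_ /(_ _ Ky)] := suppP u cK K0.
  have [_ /(_ _ Kx)] := suppP (- u) cK K0.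
  by rewrite dotNr; lra.
have [j uj] : exists j, u 0 j != 0.
  apply: contrapT => nj; move/eqP: u0; apply; apply/rowP => j.
  by rewrite mxE; apply/eqP/negPn/negP => uj; apply: nj; exists j.
have := cent b ob j.
have -> : of_coords b @^-1` orthogonal_projection <[u]>%VS K =
    [set t | - supp K (- u) <= \sum_i tnth t i <= supp K u].
  apply/seteqP; split => t /=.
    move=> [x Kx] /(_ w); rewrite coordE /= !dotE uu mulr1 => /subr0_eq xt.
    by apply/(projection_line _ bK uu); exists x.
  move=> /(projection_line _ bK uu)[x Kx xt]; exists x => // z.
  have /vlineP[k ->] := subvsP z.
  by rewrite coordE !dotE uu xt; lra.
under eq_integral do rewrite coordE mxE.
rewrite (integral_lebesgue_tuple1 _ dim1 ab) => -[].
move=> /eqP; rewrite !mulf_eq0 (negPf uj) invr_eq0 pnatr_eq0 orbF /= subr_eq0.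
by rewrite sqrrN eqf_sqr => /orP[/eqP ->//|/eqP ba]; lra.
Qed.

End Lines.

(** * Projections onto planes *)

Section Planes.
Variables (R : realType) (n : nat) (H : {vspace 'rV[R]_n}).
Implicit Types (K : set 'rV[R]_n) (w x y z p q : subvs_of H).
Implicit Types T : subvs_of H -> subvs_of H.

Local Notation sdot x y := (dot (vsval x) (vsval y)).

Lemma enorm_le (u : 'rV[R]_n) r : 0 <= r -> (enorm u <= r) = (dot u u <= r ^+ 2).
Proof. by move=> r0; rewrite -enorm_sqr ler_sqr ?nnegrE // sqrtr_ge0. Qed.

Lemma sdot_eq x y : sdot (x - y) (x - y) = 0 -> x = y.
Proof. by move/eqP; rewrite dot_eq0 linearB /= subr_eq0 => /eqP/subvs_inj. Qed.

Lemma ISO_dot T x y : ISO T -> sdot (T x - T 0) (T y - T 0) = sdot x y.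
Proof.
move=> [_ iT].
have dT a b : sdot (T a - T b) (T a - T b) = sdot (a - b) (a - b).
  by rewrite -!enorm_sqr iT.
have := dT x y; have := dT x 0; have := dT y 0; rewrite !subr0.
rewrite (_ : T x - T y = (T x - T 0) - (T y - T 0)); last by rewrite opprB addrA subrK.
move: (T x - T 0) (T y - T 0) => a b.
by rewrite !linearB /= !dotE (dotC (vsval b) (vsval a)) (dotC (vsval y) (vsval x)); lra.
Qed.

(** The squared length of the difference of the two sides expands into inner products, which stay
    the same when [T] is removed and then cancel. *)
Lemma dot_isometry_linear T a b x y :
  (forall x y, sdot (T x) (T y) = sdot x y) ->
  T (a *: x + b *: y) = a *: T x + b *: T y.
Proof.
move=> dT; apply: sdot_eq; set s := a *: x + b *: y.
have := dT s s; have := dT s x; have := dT s y; have := dT x y.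
have := dT x x; have := dT y y.
rewrite /s !(linearB, linearD, linearZ) /= !dotE.
rewrite !(dotC (vsval (T y))) !(dotC (vsval y) (vsval x)).
rewrite (dotC (vsval (T x)) (vsval (T (a *: x + b *: y)))).
move=> -> -> -> h1 h2 h3; rewrite h1 h2 h3; lra.
Qed.

(** For [z] in [H], a point and its projection have the same inner product with [z], so the
    projection of [K] has the support function of [K] restricted to [H]. *)
Lemma projection_supp K z : compact K -> K !=set0 ->
  (forall u, exists x, forall w, dot (u - vsval x) (vsval w) = 0) ->
  (exists2 x, orthogonal_projection H K x & sdot x z = supp K (vsval z)) /\
  (forall x, orthogonal_projection H K x -> sdot x z <= supp K (vsval z)).
Proof.
move=> cK K0 pr; have [[u Ku <-] uz] := suppP (vsval z) cK K0; split.
  have [x ux] := pr u; exists x; first by exists u.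
  by have := ux z; rewrite dotDl dotNl => /subr0_eq.
move=> x [v Kv /(_ z)]; rewrite dotDl dotNl => /subr0_eq <-.
exact: uz.
Qed.

(* h (U v) = <T 0, U v> + h v for the linear part U of T; since h is even, the
   left-hand sides for v and -v agree, so T 0 is orthogonal to the range of U. *)
Lemma Sym_projection K T : compact K -> K !=set0 ->
  (forall u, exists x, forall w, dot (u - vsval x) (vsval w) = 0) ->
  (forall u, supp K (- u) = supp K u) ->
  Sym (orthogonal_projection H K) T ->
  [/\ T 0 = 0, forall x y, sdot (T x) (T y) = sdot x y &
      forall x, supp K (vsval (T x)) = supp K (vsval x)].
Proof.
move=> cK K0 pr ev [iT TA]; set A := orthogonal_projection H K in TA.
pose U x := T x - T 0.
have dU x y : sdot (U x) (U y) = sdot x y by exact: ISO_dot.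
have hU v : supp K (vsval (U v)) = sdot (T 0) (U v) + supp K (vsval v).
  have UT a : sdot (T a) (U v) = sdot (T 0) (U v) + sdot a v.
    by rewrite -(dU a v) -dotDl -linearD /= /U subrKC.
  have [[x Ax xE] Umax] := projection_supp (U v) cK K0 pr.
  have [[y Ay yv] vy] := projection_supp v cK K0 pr.
  apply/eqP; rewrite eq_le; apply/andP; split.
    by rewrite -xE; move: Ax; rewrite -/A -TA => -[a Aa <-]; rewrite UT lerD2l vy.
  by rewrite -yv -UT; apply: Umax; rewrite -/A -TA; exists y.
have T00 : T 0 = 0.
  (* Surjectivity provides [v] with [U v = T 0], so that the inner product forced to vanish is the
     squared length of [T 0]. *)
  have [g _ gK] := iT.1; pose v := g (T 0 + T 0).
  have Uv : U v = T 0 by rewrite /U /v gK addrK.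
  have UN : U (- v) = - U v.
    have := @dot_isometry_linear U (-1) 0 v 0 dU.
    by rewrite !scale0r !addr0 !scaleN1r.
  have := hU v; have := hU (- v).
  rewrite UN Uv !linearN /= !ev dotNr => h1 h2.
  by apply: sdot_eq; rewrite subr0; lra.
have UT x : U x = T x by rewrite /U T00 subr0.
split => // [x y|x]; first by rewrite -!UT.
by rewrite -UT hU T00 linear0 dot0l add0r.
Qed.

(** For a unit vector [p] this triples the component along [p] and fixes its orthogonal
    complement. *)
Definition stretch p w := w + (2 * sdot w p) *: p.

Lemma stretch_linear p : linear (stretch p).
Proof.
move=> a x y; rewrite /stretch linearP dotDl dotZl scalerDr addrACA; congr (_ + _).
by rewrite scalerA -scalerDl; congr (_ *: _); lra.
Qed.

HB.instance Definition _ p :=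
  GRing.isLinear.Build R _ _ _ (stretch p) (stretch_linear p).

(** The image contains [3 p] and [- 3 p], so a ball equal to it would have radius at least 3,
    wherever its centre is. Yet its points have inner product with [q] of absolute value at most 1,
    which bounds the radius by 1. *)
Lemma stretch_not_ball p q : sdot p p = 1 -> sdot q q = 1 -> sdot p q = 0 ->
  ~ Defs.is_ball
      [set 0 + linfun (stretch p) x | x in [set x | enorm (vsval x) <= 1]].
Proof.
move=> pp qq pq [c [r [r0 Er]]].
have inE x : sdot x x <= 1 -> sdot (stretch p x - c) (stretch p x - c) <= r ^+ 2.
  move=> x1; rewrite -(enorm_le _ (ltW r0)).
  suff : [set x | enorm (vsval (x - c)) <= r] (stretch p x) by [].
  rewrite -Er; exists x; last by rewrite lfunE add0r.
  by rewrite /= enorm_le // expr1n.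
have outE y : sdot (y - c) (y - c) <= r ^+ 2 -> `|sdot y q| <= 1.
  rewrite -(enorm_le _ (ltW r0)) => yr.
  have : [set x | enorm (vsval (x - c)) <= r] y by [].
  rewrite -Er => -[x /=]; rewrite enorm_le // expr1n lfunE add0r => xx <-.
  have -> : sdot (stretch p x) q = sdot x q.
    by rewrite linearD linearZ /= dotDl dotZl pq mulr0 addr0.
  have := dot_ge0 (vsval x + vsval q); have := dot_ge0 (vsval x - vsval q).
  rewrite !dotE qq (dotC (vsval q)) ler_norml => h1 h2.
  by apply/andP; split; lra.
have p3 : stretch p p = 3 *: p.
  have -> : 3 = 1 + 2 * 1 :> R by lra.
  by rewrite /stretch pp scalerDl scale1r.
have p3N : stretch p (- p) = - (3 *: p) by rewrite -p3 -linearN.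
have := inE p; have := inE (- p).
rewrite p3N p3 !linearD !linearN !linearZ /= !dotE (dotC (vsval c)) pp.
move=> /(_ ltac:(lra)) h1 /(_ ltac:(lra)) h2.
have := outE (c + r *: q); have := outE (c - r *: q).
rewrite ![c + _]addrC !addrK !linearD !linearN !linearZ /= !dotE qq !ler_norml.
move=> /(_ ltac:(lra)) /andP[h3 h4] /(_ ltac:(lra)) /andP[h5 h6].
have cc := dot_ge0 (vsval c); have r1 : r <= 1 by lra.
have : r ^+ 2 <= 1 by rewrite expr_le1 // ltW.
by lra.
Qed.

End Planes.

(** * Symmetry groups of projections onto planes *)

Section PlanarSymmetries.
Variables (R : realType) (n : nat).
Implicit Types (K : set 'rV[R]_n) (e u v : 'rV[R]_n) (a b s t : R).

Lemma circ_sin0 e1 e2 a t : sin a = 0 -> circ e1 e2 (a + t) = cos a *: circ e1 e2 t.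
Proof.
move=> sa; rewrite /circ cosD sinD sa !mul0r subr0 add0r scalerDr !scalerA.
by [].
Qed.

(** Otherwise every symmetry maps some fixed unit vector [p t0] to itself or its opposite, hence
    commutes with the stretch along it and preserves a non-circular ellipse, against
    completeness. *)
Lemma plane_period K e1 e2 : convex_body K ->
  (forall u, supp K (- u) = supp K u) -> orthonormal2 e1 e2 ->
  complete_group (Sym (orthogonal_projection (<[e1]> + <[e2]>)%VS K)) ->
  exists2 b, sin b != 0 & periodic (supp K \o circ e1 e2) b.
Proof.
move=> [cK _ Kint] ev [e11 e22 e12] compl.
have K0 : K !=set0 by have [p /nbhs_singleton Kp] := Kint; exists p.
set H := (<[e1]> + <[e2]>)%VS in compl *.
have e1H : e1 \in H by rewrite -[e1]addr0 memv_add ?mem0v ?memv_line.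
have e2H : e2 \in H by rewrite -[e2]add0r memv_add ?mem0v ?memv_line.
pose w1 : subvs_of H := Subvs e1H; pose w2 : subvs_of H := Subvs e2H.
have HP (x : subvs_of H) : vsval x = dot (vsval x) e1 *: e1 + dot (vsval x) e2 *: e2.
  have /memv_addP[_ /vlineP[a ->] [_ /vlineP[b ->] ->]] := subvsP x.
  by rewrite !dotE (dotC e2 e1) e11 e22 e12 !mulr0 !mulr1 addr0 add0r.
have pr u : exists x : subvs_of H, forall w : subvs_of H, dot (u - vsval x) (vsval w) = 0.
  exists (dot u e1 *: w1 + dot u e2 *: w2) => w.
  by rewrite (HP w) linearD !linearZ /= !dotE (dotC e2 e1) e11 e22 e12; lra.
pose p t : subvs_of H := cos t *: w1 + sin t *: w2.
have pE t : vsval (p t) = circ e1 e2 t by [].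
apply: contrapT => noper.
have per0 b : periodic (supp K \o circ e1 e2) b -> sin b = 0.
  by move=> hb; apply/eqP/negPn/negP => sb; apply: noper; exists b.
have cc b : sin b = 0 -> cos b = 1 \/ cos b = -1.
  move=> sb; have /eqP := cos2Dsin2 b; rewrite sb expr0n addr0 sqrf_eq1.
  by move=> /orP[/eqP|/eqP]; [left|right].
set G := Sym _ in compl.
have GP T : G T -> (exists2 a, sin a = 0 & forall t, T (p t) = cos a *: p t) \/
    exists a, forall t, T (p t) = p (a - t).
  move=> /(Sym_projection cK K0 pr ev)[_ dT hT].
  have lT t : T (p t) = cos t *: T w1 + sin t *: T w2.
    exact: dot_isometry_linear.
  have := dT w1 w1; have := dT w2 w2; have := dT w1 w2.
  rewrite /= e11 e22 e12 (HP (T w1)) (HP (T w2)).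
  set c1 := dot _ e1; set s1 := dot _ e2; set c2 := dot _ e1; set s2 := dot _ e2.
  rewrite !dotE (dotC e2 e1) e11 e22 e12 => h12 h22 h11.
  have [a [ca sa]] : exists a, c1 = cos a /\ s1 = sin a.
    by apply: unit_pair_circ; lra.
  have aa := cos2Dsin2 a; rewrite ca sa in h12 h11.
  have h0 : cos a * c2 + sin a * s2 = 0 by lra.
  (* [q] is the determinant of [T]: the value 1 gives the rotation by [a], and -1 a reflection. A
     rotation by [a] makes [a] a period, whence [sin a = 0]. *)
  pose q := - c2 * sin a + s2 * cos a.
  have c2E : c2 = - q * sin a.
    have -> : - q * sin a = c2 * (cos a ^+ 2 + sin a ^+ 2)
      - cos a * (cos a * c2 + sin a * s2) by rewrite /q; lra.
    by rewrite aa h0; lra.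
  have s2E : s2 = q * cos a.
    have -> : q * cos a = s2 * (cos a ^+ 2 + sin a ^+ 2)
      - sin a * (cos a * c2 + sin a * s2) by rewrite /q; lra.
    by rewrite aa h0; lra.
  have /eqP : q ^+ 2 = 1.
    have -> : q ^+ 2 = q ^+ 2 * (cos a ^+ 2 + sin a ^+ 2) by rewrite aa mulr1.
    by rewrite -h22 c2E s2E; lra.
  have TE t : vsval (T (p t)) = (cos t * cos a - q * (sin t * sin a)) *: e1
      + (cos t * sin a + q * (sin t * cos a)) *: e2.
    rewrite lT linearD !linearZ /= (HP (T w1)) (HP (T w2)) -/c1 -/c2 -/s1 -/s2.
    rewrite ca sa c2E s2E !scalerDr !scalerA addrACA -!scalerDl.
    by congr (_ *: _ + _ *: _); rewrite /GRing.scale /=; lra.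
  rewrite sqrf_eq1 => /orP[]/eqP q1.
  - have Tp t : T (p t) = p (a + t).
      apply: subvs_inj; rewrite TE pE /circ cosD sinD q1.
      by congr (_ *: _ + _ *: _); lra.
    have a0 : sin a = 0.
      by apply: per0 => t /=; rewrite addrC -!pE -Tp hT.
    left; exists a => // t; apply: subvs_inj.
    by rewrite Tp linearZ pE circ_sin0.
  - right; exists a => t; apply: subvs_inj.
    rewrite TE pE /circ cosB sinB q1.
    by congr (_ *: _ + _ *: _); lra.
(* If there is a reflection, [p (a1 / 2)] spans its axis. Any other reflection differs from it by a
   rotation that preserves [supp K], hence by a sign. Without reflections all symmetries are plus or
   minus the identity on the circle, and [t0 = 0] will do. *)
have [t0 Gt0] : exists t0, forall T, G T -> T (p t0) = p t0 \/ T (p t0) = - p t0.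
  have [[T1 [GT1 [a1 T1p]]]|norefl] :=
      pselect (exists T1, G T1 /\ exists a1, forall t, T1 (p t) = p (a1 - t)).
    exists (a1 / 2) => T GT; have [[a sa ->]|[a Tp]] := GP T GT.
      by have [->|->] := cc a sa; rewrite ?scale1r ?scaleN1r; [left|right].
    have [_ _ hT] := Sym_projection cK K0 pr ev GT.
    have [_ _ hT1] := Sym_projection cK K0 pr ev GT1.
    have sb : sin (a - a1) = 0.
      apply: per0 => t /=; rewrite -!pE.
      have -> : t + (a - a1) = a - (a1 - t) by lra.
      by rewrite -Tp hT -T1p hT1.
    have TpE : T (p (a1 / 2)) = cos (a - a1) *: p (a1 / 2).
      apply: subvs_inj; rewrite [RHS]linearZ Tp.
      have -> : a - a1 / 2 = a - a1 + a1 / 2 by lra.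
      exact: circ_sin0.
    by have [c1|c1] := cc _ sb; rewrite TpE c1 ?scale1r ?scaleN1r; [left|right].
  exists 0 => T GT; have [[a sa ->]|[a Tp]] := GP T GT.
    by have [->|->] := cc a sa; rewrite ?scale1r ?scaleN1r; [left|right].
  by case: norefl; exists T; split => //; exists a.
have pp t : dot (vsval (p t)) (vsval (p t)) = 1.
  by rewrite pE /circ !dotE (dotC e2 e1) e11 e22 e12; have := cos2Dsin2 t; lra.
have pq t : dot (vsval (p t)) (vsval (p (t + pi / 2))) = 0.
  rewrite !pE /circ cosDpihalf sinDpihalf !dotE (dotC e2 e1) e11 e22 e12; lra.
apply: (stretch_not_ball (pp t0) (pp (t0 + pi / 2)) (pq t0)).
apply: compl.
  exists 0, (linfun (stretch (p t0))); split => //.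
  apply/eqP; rewrite -subv0; apply/subvP => w.
  rewrite memv_ker lfunE /= memv0 => /eqP w0.
  have : dot (vsval (stretch (p t0) w)) (vsval (p t0)) = 0.
    by rewrite w0 dot0l.
  rewrite linearD linearZ /= dotDl dotZl pp mulr1 => wp.
  by move: w0; rewrite /stretch (_ : dot _ _ = 0) ?mulr0 ?scale0r ?addr0; [move=> ->|lra].
move=> T GT; have [T0 dT _] := Sym_projection cK K0 pr ev GT.
split; first exact: GT.1.
have linT a x b y : T (a *: x + b *: y) = a *: T x + b *: T y.
  exact: dot_isometry_linear.
have ls w : T (stretch (p t0) w) = stretch (p t0) (T w).
  rewrite /stretch -[w in T (w + _)]scale1r linT scale1r; congr (_ + _).
  have := dT w (p t0).
  have vN : vsval (- p t0) = - vsval (p t0) by exact: linearN.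
  by have [->|->] := Gt0 T GT => <- //; rewrite vN dotNr mulrN scalerN scaleNr opprK.
have nT x : enorm (vsval (T x)) = enorm (vsval x) by rewrite /enorm dT.
apply/seteqP; split => y /=.
  move=> [_ [x x1 <-] <-]; exists (T x); first by rewrite /= nT.
  by rewrite !lfunE /= !add0r ls.
move=> [x x1 <-]; have [g _ gK] := GT.1.1.
exists (0 + linfun (stretch (p t0)) (g x)).
  by exists (g x) => //=; rewrite -nT gK.
by rewrite !lfunE /= !add0r ls gK.
Qed.

End PlanarSymmetries.

(** * Conclusion *)

(** Gram-Schmidt puts [v] on a great circle through [u], unless [v] is [u] or [- u], where evenness
    suffices. *)
Lemma even_circ_cst_unit (R : realType) (n : nat) (h : 'rV[R]_n -> R) :
  (forall u, h (- u) = h u) ->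
  (forall e1 e2 t, orthonormal2 e1 e2 -> h (circ e1 e2 t) = h e1) ->
  forall u v, dot u u = 1 -> dot v v = 1 -> h v = h u.
Proof.
move=> hN hcirc u v uu vv; set c := dot u v; pose d := v - c *: u.
have ud : dot u d = 0 by rewrite /d !dotE uu mulr1 subrr.
have vE : v = c *: u + d by rewrite /d addrC subrK.
have dd : dot d d = 1 - c ^+ 2.
  rewrite {1}/d !(dotDl, dotNl, dotZl) ud /d !(dotDr, dotNr, dotZr) vv.
  by rewrite (dotC v u) -/c; lra.
have [d0|/normalize_dot[a a0 da]] := eqVneq d 0.
  move: dd; rewrite d0 dot0l => /esym/eqP; rewrite subr_eq0 eq_sym sqrf_eq1.
  by rewrite vE d0 addr0 => /orP[]/eqP ->; rewrite ?scale1r // scaleN1r hN.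
have a0' : a != 0 by rewrite gt_eqF.
have [|t [ct st]] := @unit_pair_circ R c a^-1.
  move: da; rewrite dotZl dotZr dd => da.
  have -> : a^-1 ^+ 2 = 1 - c ^+ 2.
    by rewrite -[RHS](mulKf a0') -[a * _](mulKf a0') da mulr1 expr2.
  by lra.
have uad : dot u (a *: d) = 0 by rewrite dotZr ud mulr0.
have <- := hcirc u (a *: d) t (And3 uu da uad).
by rewrite /circ -ct -st scalerA mulVf // scale1r -vE.
Qed.

Theorem corollary1p6 (R : realType) (n : nat) (hn : (3 <= n)%N)
    (K : set 'rV[R]_n) (hK : convex_body K)
    (hproj : forall H : {vspace 'rV[R]_n}, (1 <= \dim H <= n - 1)%N ->
       completely_symmetric (orthogonal_projection H K)) :
  exists2 r : R, 0 < r & K = [set x | enorm x <= r].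
Proof.
have [cK _ Kint] := hK.
have K0 : K !=set0 by have [p /nbhs_singleton Kp] := Kint; exists p.
have n2 : (2 <= n - 1)%N by rewrite leq_subRL // (leq_trans _ hn).
have even_unit u : dot u u = 1 -> supp K (- u) = supp K u.
  move=> uu; have u0 : u != 0 by rewrite -dot_eq0 uu oner_neq0.
  have [] := hproj <[u]>%VS.
    by rewrite dim_vline u0 (leq_trans _ n2).
  by move=> cent _; exact: centroid_line.
have even u : supp K (- u) = supp K u.
  have [->|/normalize_dot[a a0 ua]] := eqVneq u 0; first by rewrite oppr0.
  apply: (mulfI (lt0r_neq0 a0)).
  by rewrite -!suppZ // scalerN even_unit.
have circE e1 e2 t : orthonormal2 e1 e2 -> supp K (circ e1 e2 t) = supp K e1.
  move: e1 e2 t; apply: great_circle_cst => //; first exact: continuous_supp.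
  move=> e1 e2 e12; apply: plane_period => //.
  have [e11 _ _] := e12; have e10 : e1 != 0 by rewrite -dot_eq0 e11 oner_neq0.
  apply: (hproj _ _).2; apply/andP; split.
    by rewrite (leq_trans _ (dimvS (addvSl _ _))) // dim_vline e10.
  apply: leq_trans n2; apply: leq_trans (dimv_add_leqif _ _) _.
  by rewrite !dim_vline; apply: (@leq_add _ _ 1 1); exact: leq_b1.
have [r Kr] : exists r, forall u, dot u u = 1 -> supp K u = r.
  have [[u uu]|nu] := pselect (exists u : 'rV[R]_n, dot u u = 1).
    by exists (supp K u) => v vv; exact: (even_circ_cst_unit even circE).
  by exists 0 => u uu; case: nu; exists u.
have [r0 KE] := supp_cst_ball hK (ltac:(exact: leq_trans hn)) Kr.
by exists r.
Qed.
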